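(* Let $X$ be a continuum that is a semi-Kelley remainder. Then $X$ is atriodic.
   Context: A continuum is a compact connected metric space with more than one point. A subcontinuum of a continuum $X$ is a non-empty compact connected subset of $X$ (one-point sets are allowed). Convergence of subcontinua is with respect to the Hausdorff metric. A compactification of $(0,1]$ with remainder $R$ is a continuum $Y=(0,1]\cup R$, where $(0,1]$ (a subspace homeomorphic to the half-open interval) is dense in $Y$ and $R$ and $(0,1]$ are disjoint. A continuum $X$ is a semi-Kelley remainder if it is the remainder of some compactification of $(0,1]$ which is a semi-Kelley continuum. A 3-od is a continuum $Z$ containing a subcontinuum $B$ (called a core of $Z$) such that $Z\setminus B$ has at least 3 components. A continuum is atriodic if it contains no 3-ods (i.e. none of its subcontinua is a 3-od). Let $K$ be a subcontinuum of a continuum $Z$. A maximal limit continuum of $K$ is a subcontinuum $M\subset K$ for which there is a sequence $\{M_n\}_{n=1}^\infty$ of subcontinua of $Z$ converging to $M$ such that for each convergent sequence $\{M_n'\}_{n=1}^\infty$ of subcontinua of $Z$ with $M_n\subset M_n'$ for each $n\in\mathbb N$ and $\lim M_n'=M'\subset K$, we have $M'=M$. A continuum $Z$ is semi-Kelley if for each subcontinuum $K$ of $Z$ and every two maximal limit continua $L$ and $M$ of $K$, either $L\subset M$ or $M\subset L$. *)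

(* Defs.v *)
From HB Require Import structures.
From mathcomp Require Import all_boot all_order all_algebra.
From mathcomp Require Import all_classical all_reals all_analysis.

Set Implicit Arguments.
Unset Strict Implicit.
Unset Printing Implicit Defensive.

Import Order.TTheory GRing.Theory Num.Theory.
Import numFieldNormedType.Exports.

Local Open Scope classical_set_scope.
Local Open Scope ring_scope.

(* Continua are sets in a metric space, with the induced metric; the ambient
   space plays no role, so [setT] recovers the case of a space as a type. *)
Definition continuum (R : realType) (T : metricType R) (X : set T) : Prop :=
  [/\ compact X, connected X & exists x y, [/\ X x, X y & x != y]].

Definition subcontinuum (R : realType) (T : metricType R) (X A : set T) : Prop :=
  [/\ A !=set0, A `<=` X, compact A & connected A].

Definition thickening (R : realType) (T : metricType R) (A : set T) (e : R) :
    set T :=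
  [set x | exists2 a, A a & mdist a x < e].

(* On nonempty bounded sets, the only ones it is applied to, the infimum is
   taken over a nonempty set that is bounded below. *)
Definition hausdorff_dist (R : realType) (T : metricType R) (A B : set T) : R :=
  inf [set e | [/\ 0 < e, A `<=` thickening B e & B `<=` thickening A e]].

Definition hausdorff_cvg (R : realType) (T : metricType R)
    (A_ : nat -> set T) (A : set T) : Prop :=
  hausdorff_dist (A_ n) A @[n --> \oo] --> (0 : R).

(* A limit in the hyperspace of subcontinua is itself a subcontinuum; asking
   this of [M'] is what makes the Hausdorff limit unique. *)
Definition maximal_limit_continuum (R : realType) (T : metricType R)
    (Z K M : set T) : Prop :=
  subcontinuum K M /\
  exists M_ : nat -> set T,
    [/\ forall n, subcontinuum Z (M_ n),
        hausdorff_cvg M_ M &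
        forall (M'_ : nat -> set T) (M' : set T),
          (forall n, subcontinuum Z (M'_ n)) ->
          (forall n, M_ n `<=` M'_ n) ->
          subcontinuum Z M' -> hausdorff_cvg M'_ M' ->
          M' `<=` K -> M' = M].

Definition semi_Kelley (R : realType) (T : metricType R) (Z : set T) : Prop :=
  continuum Z /\
  forall K, subcontinuum Z K ->
  forall L M, maximal_limit_continuum Z K L -> maximal_limit_continuum Z K M ->
    L `<=` M \/ M `<=` L.

Definition homeomorphic (S T : topologicalType) (A : set S) (B : set T) : Prop :=
  exists (f : S -> T) (g : T -> S),
    [/\ {within A, continuous f} /\ {within B, continuous g},
        (forall x, A x -> B (f x)), (forall y, B y -> A (g y)),
        (forall x, A x -> g (f x) = x) & (forall y, B y -> f (g y) = y)].

(* [Y] is a compactification of (0,1] with remainder [Q]; [J] is the copy of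
   (0,1] inside [Y]. *)
Definition ray_compactification (R : realType) (T : metricType R)
    (Y J Q : set T) : Prop :=
  [/\ continuum Y, Y = J `|` Q, J `&` Q = set0,
      homeomorphic J (`]0, 1]%classic : set R) & Y `<=` closure J].

(* Being the remainder is meant up to homeomorphism, [X] and its
   compactification being a priori sets in different metric spaces. *)
Definition semi_Kelley_remainder (R : realType) (T : metricType R) (X : set T) :
    Prop :=
  exists (S : metricType R) (Y J Q : set S),
    [/\ ray_compactification Y J Q, semi_Kelley Y & homeomorphic X Q].

Definition components (T : topologicalType) (A : set T) : set (set T) :=
  connected_component A @` A.

Definition three_od_core (R : realType) (T : metricType R) (Z B : set T) : Prop :=
  subcontinuum Z B /\
  exists C1 C2 C3,
    [/\ components (Z `\` B) C1, components (Z `\` B) C2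
      & components (Z `\` B) C3] /\
    [/\ C1 <> C2, C1 <> C3 & C2 <> C3].

Definition three_od (R : realType) (T : metricType R) (Z : set T) : Prop :=
  continuum Z /\ exists B, three_od_core Z B.

Definition atriodic (R : realType) (T : metricType R) (X : set T) : Prop :=
  continuum X /\ forall Z, subcontinuum X Z -> ~ three_od Z.

(* Main.v *)
Require Import Defs.
From mathcomp Require Import all_boot all_order all_algebra.
From mathcomp Require Import all_classical all_reals all_analysis.

(**
Suppose that the remainder [Q] of a semi-Kelley compactification [Y] of a ray
[J] contains a 3-od; it then contains continua [B1], [B2], [B3] with common
pairwise intersection a continuum [B], and points [p_i] of [B_i] outside [B].
Approximating a point by points of [J] produces a maximal limit continuum of
[B1 `|` B2] through it, and these are nested, so one of them contains both [p1]
and [p2]; it is a limit of arcs of [J].  Cutting these arcs near [p1] and [p2]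
gives a continuum [N] in [B1 `|` B2] that reaches into both legs but misses
[p1] and [p2].  Any connected set containing a cut arc and missing the ends of
the uncut one stays inside the latter; hence for every continuum [K] containing
[N] and missing [p1] and [p2], [N] extends to a maximal limit continuum of [K]
that lies in [B1 `|` B2].  Get [N'] from [B1 `|` B3] in the same way.  For
[K = N `|` B `|` N'] the two maximal limit continua are not nested.
*)

Set Implicit Arguments.
Unset Strict Implicit.
Unset Printing Implicit Defensive.

Import Order.TTheory GRing.Theory Num.Theory.
Import numFieldNormedType.Exports.

Local Open Scope classical_set_scope.
Local Open Scope ring_scope.

(** * Thickenings and Hausdorff convergence *)

Section Thickening.
Context {R : realType} {T : metricType R}.
Implicit Types (A B E F : set T) (e d : R).

Lemma thickeningS A B d e :
  A `<=` B -> d <= e -> thickening A d `<=` thickening B e.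
Proof.
by move=> AB de x [a Aa ax]; exists a; [exact: AB|exact: lt_le_trans ax de].
Qed.

Lemma thickening_thickening A d e :
  thickening (thickening A d) e `<=` thickening A (d + e).
Proof.
move=> x [y [a Aa ay] yx]; exists a => //.
by rewrite (le_lt_trans (metric_triangle a y x))// ltrD.
Qed.

Lemma open_thickening A e : open (thickening A e).
Proof.
have -> : thickening A e = \bigcup_(a in A) [set x | mdist a x < e].
  by apply/seteqP; split => [x [a Aa ax]|x [a Aa ax]]; exists a.
apply: bigcup_open => a Aa.
rewrite openE => x /= axe.
rewrite /interior; apply/nbhs_ballP; exists (e - mdist a x).
  by rewrite /= subr_gt0.
move=> y; rewrite ballEmdist/= ltrBrDl.
exact/le_lt_trans/metric_triangle.
Qed.

Lemma sub_thickening A e : 0 < e -> A `<=` thickening A e.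
Proof. by move=> e0 x Ax; exists x => //; rewrite mdistxx. Qed.

Lemma closureP A x :
  closure A x <-> forall e, 0 < e -> thickening A e x.
Proof.
split=> [clx e e0|h B /nbhs_ballP[e e0 eB]].
  have [a [Aa]] := clx _ (nbhsx_ballx x e e0).
  by rewrite ballEmdist/= metric_sym => ax; exists a.
have [a Aa ax] := h _ e0; exists a; split => //; apply: eB.
by rewrite ballEmdist/= metric_sym.
Qed.

Lemma closed_thickening A x :
  closed A -> (forall e, 0 < e -> thickening A e x) -> A x.
Proof. by move=> cA h; apply: cA; apply/closureP. Qed.

Lemma closure_thickening A d e : d < e ->
  closure (thickening A d) `<=` thickening A e.
Proof.
move=> de x /closureP/(_ (e - d)); rewrite subr_gt0 => /(_ de).
by move/thickening_thickening; rewrite addrC subrK.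
Qed.

Lemma compact_metric_closed A : compact A -> closed A.
Proof. by move=> cA; apply: compact_closed => //; exact: metric_hausdorff. Qed.

(** A Lebesgue number argument in the near-covering form of compactness: if the ball of radius [r]
    around [x] lies in [O], then every radius below [r / 2] serves all centres within [r / 2] of
    [x]. *)
Lemma compact_sub_thickening A O : compact A -> open O -> A `<=` O ->
  exists2 e, 0 < e & thickening A e `<=` O.
Proof.
move=> /compact_near_coveringP cA oO AO.
have := cA R (0^'+) (fun e x => forall y, mdist x y < e -> O y) _.
have h x : A x -> \forall x' \near x & e \near 0^'+,
    forall y, mdist x' y < e -> O y.
  move=> Ax; have /nbhs_ballP[r /= r0 rO] : nbhs x O.
    by apply: open_nbhs_nbhs; split => //; exact: AO.
  exists (ball x (r / 2), [set e | e < r / 2]) => /=.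
    split; first by apply: nbhsx_ballx; rewrite divr_gt0.
    by apply: nbhs_right_lt; rewrite divr_gt0.
  move=> [x' e] /= [+ er] y x'y; rewrite ballEmdist/= => xx'.
  apply: rO; rewrite ballEmdist/= (le_lt_trans (metric_triangle x x' y))//.
  by rewrite [r]splitr ltrD// (lt_trans x'y).
move=> /(_ _ h) h'.
near (0 : R)^'+ => e; exists e => //=.
move=> y [a Aa ay].
have /(_ _ Aa) : A `<=` (fun x => forall y, mdist x y < e -> O y).
  by near: e.
exact.
Unshelve. all: by end_near. Qed.

Lemma open_separated A B : open A -> open B -> A `&` B = set0 -> separated A B.
Proof.
move=> oA oB AB0; split; apply/seteqP; split => // x.
  move=> [cA Bx]; have [y [Ay By]] := cA _ (open_nbhs_nbhs (conj oB Bx)).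
  by have : (A `&` B) y by []; rewrite AB0.
move=> [Ax cB]; have [y [By Ay]] := cB _ (open_nbhs_nbhs (conj oA Ax)).
by have : (A `&` B) y by []; rewrite AB0.
Qed.

Lemma compact_disjoint_thickening E F : compact E -> compact F ->
  E `&` F = set0 ->
  exists2 e, 0 < e & thickening E e `&` thickening F e = set0.
Proof.
move=> cE cF EF0.
have [e e0 eF] : exists2 e, 0 < e & thickening E e `<=` ~` F.
  apply: compact_sub_thickening => //.
    by apply: closed_openC; exact: compact_metric_closed.
  by apply/disjoints_subset.
exists (e / 2); first by rewrite divr_gt0.
apply/seteqP; split => // x [[a Ea ax] [b Fb bx]].
apply: (eF b) => //; exists a => //.
rewrite (le_lt_trans (metric_triangle a x b))//.
by rewrite [e]splitr ltrD// metric_sym.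
Qed.

End Thickening.

Section HausdorffConvergence.
Context {R : realType} {T : metricType R}.
Implicit Types (A B Y : set T) (e : R).

(** Hausdorff convergence freed of the infimum; [hausdorff_nearP] identifies it with [hausdorff_cvg]
    for nonempty subsets of a compact set. *)
Definition hausdorff_near (A_ : nat -> set T) A := forall e : R, 0 < e ->
  \forall n \near \oo, A_ n `<=` thickening A e /\ A `<=` thickening (A_ n) e.

Lemma compact_bounded_mdist Y : compact Y ->
  exists D : R, forall x y, Y x -> Y y -> mdist x y < D.
Proof.
move=> cY; have [[y0 Yy0]|Y0] := pselect (Y !=set0); last first.
  by exists 0 => x y Yx; exfalso; apply: Y0; exists x.
have h x : Y x -> \forall x' \near x & D \near +oo, mdist y0 x' < D.
  move=> Yx; exists (ball x 1, [set D | mdist y0 x + 1 < D]) => /=.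
    split; first exact: nbhsx_ballx.
    by apply: nbhs_pinfty_gt; exact: num_real.
  move=> [x' D] /= [+ xD]; rewrite ballEmdist/= => xx'.
  rewrite (le_lt_trans (metric_triangle y0 x x'))// (lt_trans _ xD)//.
  by rewrite ltrD2l.
have /compact_near_coveringP/(_ R +oo (fun D x => mdist y0 x < D) _ h) h' := cY.
near (pinfty_nbhs R) => D.
have DY : Y `<=` (fun x => mdist y0 x < D) by near: D.
exists (D + D) => x y Yx Yy.
rewrite (le_lt_trans (metric_triangle x y0 y))// ltrD//; last exact: DY.
by rewrite metric_sym; exact: DY.
Unshelve. all: by end_near. Qed.

(** The admissible radius asked for keeps the infimum off the empty set, where [inf] takes the
    default value 0 and carries no information. *)
Lemma hausdorff_dist_lt A B e : hausdorff_dist A B < e ->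
    (exists d : R, [/\ 0 < d, A `<=` thickening B d & B `<=` thickening A d]) ->
  A `<=` thickening B e /\ B `<=` thickening A e.
Proof.
move=> He [d0 d0E].
have [d [_ AB BA] /ltW de] : exists2 d, [/\ 0 < d, A `<=` thickening B d &
    B `<=` thickening A d] & d < e by apply: inf_lt => //; exists d0.
by split; [apply: subset_trans AB _|apply: subset_trans BA _];
  exact: thickeningS.
Qed.

Lemma hausdorff_dist_le A B e : 0 < e ->
  A `<=` thickening B e -> B `<=` thickening A e -> hausdorff_dist A B <= e.
Proof. by move=> e0 AB BA; apply: ge_inf => //; exists 0 => d [/ltW]. Qed.

Lemma hausdorff_dist_ge0 A B : 0 <= hausdorff_dist A B.
Proof.
rewrite /hausdorff_dist; set E := (X in inf X).
have [E0|/set0P/negP] := pselect (E !=set0).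
  by apply: lb_le_inf => // d [/ltW].
by rewrite negbK => /eqP ->; rewrite inf0.
Qed.

Lemma hausdorff_nearP Y (A_ : nat -> set T) A : compact Y ->
  (forall n, A_ n !=set0 /\ A_ n `<=` Y) -> A !=set0 -> A `<=` Y ->
  hausdorff_cvg A_ A <-> hausdorff_near A_ A.
Proof.
move=> cY AY A0 sAY; split.
  move=> /cvgrPdist_lt h e e0; have := h _ e0; apply: filterS => n.
  rewrite sub0r normrN ger0_norm ?hausdorff_dist_ge0// => /hausdorff_dist_lt.
  (* A strict bound on all distances in [Y] is an admissible radius between nonempty subsets of
     [Y]. *)
  apply; have [D DY] := compact_bounded_mdist cY.
  have [[a Aa] [[b Ab] sAn]] := (A0, AY n).
  exists D; split.
  - by apply: le_lt_trans (DY a a _ _); [exact: mdist_ge0|exact: sAY..].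
  - by move=> x Ax; exists a => //; apply: DY; [exact: sAY|exact: sAn].
  - by move=> x Ax; exists b => //; apply: DY; [exact: sAn|exact: sAY].
move=> h; apply/cvgrPdist_le => e e0.
have := h _ e0; apply: filterS => n [h1 h2].
by rewrite sub0r normrN ger0_norm ?hausdorff_dist_ge0// hausdorff_dist_le.
Qed.

Lemma hausdorff_near_closed (A_ : nat -> set T) A x : closed A ->
  hausdorff_near A_ A ->
  (forall e, 0 < e -> \forall n \near \oo, thickening (A_ n) e x) -> A x.
Proof.
move=> cA AA h; apply: closed_thickening => // e e0.
have e20 : 0 < e / 2 by rewrite divr_gt0.
near \oo => n.
have [An _] : A_ n `<=` thickening A (e / 2) /\
    A `<=` thickening (A_ n) (e / 2).
  by near: n; exact: AA.
rewrite [e]splitr; apply: thickening_thickening.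
by apply: (thickeningS An (lexx _)); near: n; exact: h.
Unshelve. all: by end_near. Qed.

Lemma hausdorff_near_sub (A_ B_ : nat -> set T) A B : closed B ->
  hausdorff_near A_ A -> hausdorff_near B_ B ->
  (\forall n \near \oo, A_ n `<=` B_ n) -> A `<=` B.
Proof.
move=> cB AA BB AB x Ax; apply: (hausdorff_near_closed cB BB) => e e0.
apply: filterS2 (AA _ e0) AB => n [_ /(_ _ Ax) h] sAB.
exact: thickeningS h.
Qed.

Lemma hausdorff_near_subset (A_ : nat -> set T) A C : closed C ->
  hausdorff_near A_ A ->
  (forall e, 0 < e -> \forall n \near \oo, A_ n `<=` thickening C e) ->
  A `<=` C.
Proof.
move=> cC AA AC x Ax; apply: closed_thickening => // e e0.
have e20 : 0 < e / 2 by rewrite divr_gt0.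
near \oo => n.
have [_ /(_ _ Ax) An] : A_ n `<=` thickening A (e / 2) /\
    A `<=` thickening (A_ n) (e / 2) by near: n; exact: AA.
rewrite [e]splitr; apply: thickening_thickening.
by apply: (thickeningS _ (lexx _) An); near: n; exact: AC.
Unshelve. all: by end_near. Qed.

Lemma hausdorff_near_subseq (A_ : nat -> set T) A (s : nat -> nat) :
  (forall k, (k <= s k)%N) -> hausdorff_near A_ A -> hausdorff_near (A_ \o s) A.
Proof.
move=> ks AA e /AA[n _ nA]; exists n => // k nk; apply: nA.
exact: leq_trans (ks k).
Qed.

(** A separation of [A] consists of two disjoint compact sets, which have disjoint thickenings. A
    set [A_ n] close to [A] lies in the union of these thickenings and meets both, so it would be
    disconnected. *)
Lemma hausdorff_near_connected (A_ : nat -> set T) A : compact A ->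
  (forall n, connected (A_ n)) -> hausdorff_near A_ A -> connected A.
Proof.
move=> cA cA_ AA; apply/connectedP => E [E0 AE [sE1 sE2]].
have cE b : compact (E b).
  apply: (subclosed_compact _ cA); last first.
    by rewrite AE; case: b => x; [right|left].
  move=> x clx.
  have : A x.
    apply: (compact_metric_closed cA); apply: closureS clx.
    by rewrite AE; case: b => y; [right|left].
  rewrite AE; case: b clx => clx [Ex|Ex]//.
  - suff : set0 x by []. by rewrite -sE2.
  - suff : set0 x by []. by rewrite -sE1.
have [e e0 thE] : exists2 e, 0 < e &
    thickening (E false) e `&` thickening (E true) e = set0.
  apply: compact_disjoint_thickening => //.
  by apply: separated_disjoint.
near \oo => n.
have [sA1 sA2] : A_ n `<=` thickening A e /\ A `<=` thickening (A_ n) e.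
  by near: n; exact: AA.
have sepE : separated (thickening (E false) e) (thickening (E true) e).
  by apply: open_separated => //; exact: open_thickening.
have hb b : exists2 y, A_ n y & thickening (E b) e y.
  have [x Ex] := E0 b.
  have [|y Ay xy] := sA2 x.
    by rewrite AE; case: (b) Ex => ?; [right|left].
  by exists y => //; exists x => //; rewrite metric_sym.
have := connected_subset sepE _ (cA_ n).
case.
- move=> x /sA1 [a]; rewrite AE => -[] Ea ax; [left|right]; by exists a.
- move=> h; have [y Ay yE] := hb true.
  suff : set0 y by []. by rewrite -thE; split => //; exact: h.
- move=> h; have [y Ay yE] := hb false.
  suff : set0 y by []. by rewrite -thE; split => //; exact: h.
Unshelve. all: by end_near. Qed.

End HausdorffConvergence.

(** * Hyperspace limits and maximal limit continua *)

Lemma eventually_and_ex (P Q : set nat) : (\forall n \near \oo, P n) ->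
  (\forall n \near \oo, Q n) -> exists n, P n /\ Q n.
Proof.
move=> hP hQ; near \oo => n; exists n.
by split; near: n.
Unshelve. all: by end_near. Qed.

(** Compactness yields a cluster point, and an ultrafilter converges to each of its cluster
    points. *)
Lemma compact_ultra_cvg (I : Type) (T : topologicalType) (U : set_system I)
    (Y : set T) (y : I -> T) : UltraFilter U -> compact Y ->
  (\forall i \near U, Y (y i)) -> exists2 z, Y z & y @ U --> z.
Proof.
move=> UU cY Yy; have [z [Yz yz]] := cY (y @ U) _ Yy.
exists z => // B Bz; have [//|nB] := in_ultra_setVsetC (y @^-1` B) UU.
by have [w [? ?]] := yz (~` B) B nB Bz.
Qed.

Definition eps {R : realType} (k : nat) : R := k.+1%:R^-1.

Lemma eps_gt0 (R : realType) k : 0 < eps k :> R.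
Proof. by rewrite invr_gt0. Qed.

Lemma eps_near (R : realType) (e : R) : 0 < e -> \forall k \near \oo, eps k < e.
Proof. by move=> e0; exact: (near_infty_natSinv_lt (PosNum e0)). Qed.

Section Diagonal.
Context {R : realType} {T : metricType R}.
Implicit Types (Y : set T) (D : nat -> nat -> set T).

(* Let [U] be a free ultrafilter on the column index.  [M] consists of the
   points that every row [D j] approaches along [U]. *)
Lemma diagonal_limit Y D (P : nat -> nat -> Prop) : compact Y ->
  (forall j n, D j n `<=` Y) ->
  (forall i j n, (i <= j)%N -> D j n `<=` D i n) ->
  (forall j, \forall n \near \oo, D j n !=set0) ->
  (forall j, \forall n \near \oo, P j n) ->
  exists (M : set T) (j_ n_ : nat -> nat),
  [/\ [/\ compact M, M !=set0 & M `<=` Y],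
    forall k, [/\ (k <= j_ k)%N, (k <= n_ k)%N & P (j_ k) (n_ k)],
    hausdorff_near (fun k => D (j_ k) (n_ k)) M &
    forall e : R, 0 < e ->
      exists i, \forall k \near \oo, D i (n_ k) `<=` thickening M e].
Proof.
move=> cY DY Ddec D0 DP.
have [U [UU ooU]] := ultraFilterLemma (eventually_filter).
pose M := Y `&` [set y | forall d j, 0 < d ->
  \forall n \near U, D j n `&` ball y d !=set0].
have clY := compact_metric_closed cY.
have cM : compact M.
  apply: (subclosed_compact _ cY) => [y clMy|y []//].
  split; first by apply: clY; apply: closureS clMy => x [].
  move=> d j d0; have d20 : 0 < d / 2 by rewrite divr_gt0.
  have [z [[_ Mz] yz]] := clMy _ (nbhsx_ballx y _ d20).
  apply: filterS (Mz _ j d20) => n [x [Dx zx]]; exists x; split => //.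
  by rewrite [d]splitr; exact: ball_triangle zx.
(* Points of [D j n] in [W] have a limit [z j] along [U] in each row [j], and these have a limit [w]
   along [U]. As the rows decrease, points near [z j] with [j] large belong to every earlier row, so
   [w] is in [M]. *)
have key W : closed W -> (forall j, \forall n \near U, D j n `&` W !=set0) ->
    M `&` W !=set0.
  move=> cW DW.
  (* A default value for the choice function [y] at pairs where [D j n] misses [W]. *)
  have [y0 _] : exists y : T, True.
    by have /filter_ex[n [y _]] := D0 0%N; exists y.
  have /choice[y yP] : forall jn : nat * nat, exists y,
      D jn.1 jn.2 `&` W !=set0 -> D jn.1 jn.2 y /\ W y.
    move=> jn; have [[y ?]|?] := pselect (D jn.1 jn.2 `&` W !=set0).
      by exists y.
    by exists y0.
  have cYW : compact (Y `&` W) by exact: compact_closedI.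
  have yDW j : \forall n \near U, D j n (y (j, n)) /\ W (y (j, n)).
    by apply: filterS (DW j) => n /(yP (j, n)).
  have /choice[z zP] : forall j, exists z, (Y `&` W) z /\
      (fun n => y (j, n)) @ U --> z.
    move=> j.
    have [|z] := @compact_ultra_cvg _ _ U _ (fun n => y (j, n)) UU cYW.
      by apply: filterS (yDW j) => n [/DY].
    by exists z.
  have [|w [Yw Ww] zw] := @compact_ultra_cvg _ _ U _ z UU cYW.
    by apply: filterE => j; have [] := zP j.
  exists w; split => //; split => // d i d0.
  have d20 : 0 < d / 2 by rewrite divr_gt0.
  have [j [ij wj]] : exists j, (i <= j)%N /\ ball w (d / 2) (z j).
    have /filter_ex[j [? ?]] :
        \forall j \near U, (i <= j)%N /\ ball w (d / 2) (z j).
      apply: filterI; last by apply: zw; exact: nbhsx_ballx.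
      by apply: ooU; exact: nbhs_infty_ge.
    by exists j.
  have zj : \forall n \near U, ball (z j) (d / 2) (y (j, n)).
    by apply: (zP j).2; exact: nbhsx_ballx.
  apply: filterS2 zj (yDW j) => n zy [Dy _]; exists (y (j, n)); split.
    exact: Ddec Dy.
  by rewrite [d]splitr; exact: ball_triangle zy.
(* If every row escaped the thickening along [U], then [key], applied to its closed complement,
   would produce a point of [M] outside a thickening of [M]. *)
have MDl (e : R) : 0 < e ->
    exists i, \forall n \near U, D i n `<=` thickening M e.
  move=> e0; apply: contrapT => /forallNP h.
  have [||w [Mw]] := key (~` thickening M e).
  - by apply: open_closedC; exact: open_thickening.
  - move=> j.
    have [/h//|] := in_ultra_setVsetC [set n | D j n `<=` thickening M e] UU.
    apply: filterS => n /= /existsNP[x /not_implyP[Dx Mx]].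
    by exists x.
  - by apply; exact: sub_thickening.
have MDr (e : R) j : 0 < e -> \forall n \near U, M `<=` thickening (D j n) e.
  move=> e0; have e20 : 0 < e / 2 by rewrite divr_gt0.
  move/compact_near_coveringP : cM.
  apply => x [Yx Mx].
  exists (ball x (e / 2), [set n | D j n `&` ball x (e / 2) !=set0]) => /=.
    by split; [exact: nbhsx_ballx|exact: Mx].
  move=> [x' n] /= [xx' [y [Dy xy]]]; exists y => //.
  have : ball y (e / 2 + e / 2) x' by apply: ball_triangle xx'; exact: ball_sym.
  by rewrite -splitr ballEmdist.
have M0 : M !=set0.
  have [|x [Mx _]] := key setT closedT; last by exists x.
  move=> j; apply: ooU; apply: filterS (D0 j) => n [x Dx]; by exists x.
have /choice[j_ j_P] : forall k, exists j, (k <= j)%N /\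
    \forall n \near U, D j n `<=` thickening M (eps k).
  move=> k; have [i iP] := MDl _ (eps_gt0 R k).
  (* The maximum makes the row index grow with [k]; the row stays close to [M] because rows
     decrease. *)
  exists (maxn k i); split; first exact: leq_maxl.
  apply: filterS iP => n; apply: subset_trans.
  by apply: Ddec; exact: leq_maxr.
(* These are finitely many conditions, each true along [U], so one [n] meets them all. Controlling
   every row [j_ i] with [i <= k], and not only the [k]-th, is what gives the last claim. *)
have /choice[n_ n_P] : forall k, exists n, [/\ (k <= n)%N, P (j_ k) n,
    M `<=` thickening (D (j_ k) n) (eps k) &
    forall i, (i <= k)%N -> D (j_ i) n `<=` thickening M (eps i)].
  move=> k.
  have h1 : \forall n \near U, (k <= n)%N by apply: ooU; exact: nbhs_infty_ge.
  have h2 : \forall n \near U, P (j_ k) n by apply: ooU; exact: DP.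
  have h3 := MDr _ (j_ k) (eps_gt0 R k).
  have h4 : \forall n \near U, forall i : 'I_k.+1,
      D (j_ i) n `<=` thickening M (eps i).
    by apply: filter_forall => i; exact: (j_P i).2.
  have [n [[n1 n2] [n3 n4]]] := @filter_ex _ U _ _
    (@filterI _ U _ _ _ (@filterI _ U _ _ _ h1 h2) (@filterI _ U _ _ _ h3 h4)).
  by exists n; split => // i ik; exact: (n4 (Ordinal (ik : (i < k.+1)%N))).
exists M, j_, n_; split.
- by split => // x [].
- by move=> k; have [? ? _ _] := n_P k; have [? _] := j_P k.
- move=> e e0; apply: filterS (eps_near e0) => k ke.
  have [_ _ h1 /(_ _ (leqnn k)) h2] := n_P k.
  by split; [apply: subset_trans h2 _|apply: subset_trans h1 _];
    apply: thickeningS => //; exact: ltW.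
- move=> e e0; have /filter_ex[i ie] := eps_near e0.
  exists (j_ i); apply: filterS (nbhs_infty_ge i) => k ik.
  have [_ _ _ /(_ _ ik) h] := n_P k.
  by apply: subset_trans h _; apply: thickeningS => //; exact: ltW.
Qed.

(** The diagonal construction with all rows equal to [N_]; the limit is connected by
    [hausdorff_near_connected]. *)
Lemma subcontinuum_compactness Y (N_ : nat -> set T) : compact Y ->
  (forall n, subcontinuum Y (N_ n)) ->
  exists N (s : nat -> nat), [/\ subcontinuum Y N, forall k, (k <= s k)%N &
    hausdorff_near (N_ \o s) N].
Proof.
move=> cY YN.
have [||||N [j_ [s [[cN N0 NY] sP hN _]]]] :=
  @diagonal_limit Y (fun _ => N_) (fun _ _ => True) cY.
- by move=> _ n; have [] := YN n.
- by move=> *; exact: subset_refl.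
- by move=> _; apply: filterE => n; have [] := YN n.
- by move=> _; exact: filterE.
exists N, s; split => //; last by move=> k; have [] := sP k.
split => //; apply: (hausdorff_near_connected cN _ hN) => k /=.
by have [] := YN (s k).
Qed.

(** Inside shrinking neighbourhoods [C j] of [K], take the component [D j n] containing [N_ n], and
    let [M] be a diagonal limit of these. Continua that contain the approximants of [M] and converge
    into [K] eventually lie in the same components, so their limit cannot exceed [M]. *)
Lemma maximal_limit_continuum_exists Y K (N_ : nat -> set T) : compact Y ->
  subcontinuum Y K -> (forall n, subcontinuum Y (N_ n)) ->
  (forall e : R, 0 < e -> \forall n \near \oo, N_ n `<=` thickening K e) ->
  exists (M : set T) (M_ : nat -> set T) (s : nat -> nat),
  [/\ maximal_limit_continuum Y K M, forall k, subcontinuum Y (M_ k),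
     forall k, (k <= s k)%N, forall k, N_ (s k) `<=` M_ k &
     hausdorff_near M_ M].
Proof.
move=> cY [K0 KY cK conK] YN NK.
have clY := compact_metric_closed cY; have clK := compact_metric_closed cK.
have /choice[x xP] : forall n, exists x, N_ n x.
  by move=> n; have [[x Nx] _ _ _] := YN n; exists x.
(* Closed neighbourhoods, for components to be closed. *)
pose C j := Y `&` closure (thickening K (eps j)).
have clC j : closed (C j) by apply: closedI => //; exact: closed_closure.
pose D j n := connected_component (C j) (x n).
have NC j : \forall n \near \oo, N_ n `<=` C j.
  apply: filterS (NK _ (eps_gt0 R j)) => n NKn y Ny; split; last first.
    by apply: subset_closure; exact: NKn.
  by have [_ NY _ _] := YN n; exact: NY.
have DY j n : D j n `<=` Y by move=> y /connected_component_sub[].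
have [|||M [j_ [s [[cM M0 MY] jsP hM Mmax]]]] :=
  @diagonal_limit Y D (fun j n => N_ n `<=` C j) cY DY.
- move=> i j n ij y [B [Bx BC cB] By].
  exists B => //; split => // z /BC[Yz clz]; split => //.
  apply: closureS clz; apply: thickeningS => //.
  by rewrite lef_pV2 ?posrE// ler_nat.
- move=> j; apply: filterS (NC j) => n NCn.
  by exists (x n); apply: connected_component_refl; exact: NCn.
- exact: NC.
pose M_ k := D (j_ k) (s k).
(* The predicate carried through the diagonal ensures that [N_ (s k)] lies in [C (j_ k)]; being
   connected, it lies in the component of its point [x (s k)]. *)
have NM k : N_ (s k) `<=` M_ k.
  have [_ _ NCk] := jsP k; have [_ _ _ cN] := YN (s k).
  exact: connected_component_max.
have YM k : subcontinuum Y (M_ k).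
  split; first (by exists (x (s k)); exact: NM); first exact: DY; last first.
    exact: component_connected.
  apply: (subclosed_compact _ cY); last exact: DY.
  by apply: component_closed.
have conM : connected M.
  by apply: (hausdorff_near_connected cM _ hM) => k; have [] := YM k.
have CK e : 0 < e -> exists i, forall j, (i <= j)%N -> C j `<=` thickening K e.
  move=> e0; have [i _ ie] := eps_near e0.
  by exists i => j /ie je y [_]; exact: closure_thickening.
have MK : M `<=` K.
  apply: (hausdorff_near_subset clK hM) => e /CK[i iK]; exists i => // k ik.
  apply: subset_trans (iK (j_ k) _); first exact: connected_component_sub.
  by have [jk _ _] := jsP k; exact: leq_trans jk.
exists M, M_, s; split => //; last by move=> k; have [] := jsP k.
split; first by split.
exists M_; split => //.
  by apply/(hausdorff_nearP cY) => // n; have [] := YM n.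
move=> M'_ M' YM'_ MM'_ [M'0 YM' cM' _] hM'_ M'K.
have {}hM'_ : hausdorff_near M'_ M'.
  by apply/(hausdorff_nearP cY) => // n; have [] := YM'_ n.
have clM' := compact_metric_closed cM'.
apply/seteqP; split; last first.
  by apply: (hausdorff_near_sub clM' hM hM'_); exact: filterE.
move=> y M'y; apply: closed_thickening => [|e e0].
  exact: compact_metric_closed.
have e20 : 0 < e / 2 by rewrite divr_gt0.
(* The components in row [i] are eventually within [e / 2] of [M]. Since [M'_ k] is eventually
   within [eps i] of [M'], hence of [K], it lies in [C i], and thus in the component [D i (s k)]. *)
have [i iM] := Mmax _ e20.
have hi := hM'_ _ (eps_gt0 R i).
have [k [[Dik [M'i _]] [_ /(_ _ M'y) M'ky]]] :=
  eventually_and_ex (filterI iM hi) (hM'_ _ e20).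
rewrite [e]splitr; apply: thickening_thickening.
apply: thickeningS M'ky => //; apply: subset_trans Dik.
have [_ M'kY _ cM'k] := YM'_ k.
apply: connected_component_max => //.
  by apply: MM'_; apply: NM.
move=> z M'z; split; first exact: M'kY.
apply: subset_closure; apply: thickeningS (M'i _ M'z) => //.
Qed.

End Diagonal.

(** * Subcontinua of a compactified ray *)

Lemma open_mdist_lt (R : realType) (T : metricType R) (p : T) (r : R) :
  open [set y | mdist y p < r].
Proof.
have := @open_thickening R T [set p] r; congr open.
apply/seteqP; split => y; first by move=> [_ ->]; rewrite metric_sym.
by rewrite /= metric_sym; exists p.
Qed.

Lemma closed_mdist_le (R : realType) (T : metricType R) (p : T) (r : R) :
  closed [set y | mdist y p <= r].
Proof.
move=> y /closureP h; apply/ler_addgt0Pr => e /h [a ap ay].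
by rewrite (le_trans (metric_triangle y a p))// addrC lerD// metric_sym ltW.
Qed.

Lemma closed_mdist_ge (R : realType) (T : metricType R) (p : T) (r : R) :
  closed [set y | r <= mdist y p].
Proof.
have -> : [set y | r <= mdist y p] = ~` [set y | mdist y p < r].
  by apply/seteqP; split => y /=; rewrite leNgt => /negP.
exact/open_closedC/open_mdist_lt.
Qed.

Lemma mem_closed_far (R : realType) (S : metricType R) (C : set S) x :
  closed C -> ~ C x ->
  exists2 d : R, 0 < d & forall y, mdist y x < d -> ~ thickening C d y.
Proof.
move=> clC Cx.
have /nbhs_ballP[d /= d0 dC] : nbhs x (~` C).
  by apply: open_nbhs_nbhs; split => //; exact: closed_openC.
exists (d / 2); first by rewrite divr_gt0.
move=> y yx [c Cc cy]; apply: dC (Cc).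
rewrite ballEmdist/= (le_lt_trans (metric_triangle x y c))//.
by rewrite [d]splitr ltrD// metric_sym.
Qed.

Lemma closed_ball_avoid (R : realType) (S : metricType R) (C : set S) p :
  closed C -> ~ C p ->
  \forall r \near 0^'+, forall x, mdist x p <= r -> ~ C x.
Proof.
move=> clC Cp; have [d d0 dC] := mem_closed_far clC Cp.
near=> r => x xp Cx; apply: (dC x).
  by rewrite (le_lt_trans xp)//; near: r; exact: nbhs_right_lt.
exact: sub_thickening.
Unshelve. all: by end_near. Qed.

(** If [N] missed the intersection, its trace on [A] would be nonempty and both open and closed in
    [N], hence all of [N]. *)
Lemma connected_meets_setI (T : topologicalType) (A B N : set T) :
  closed A -> closed B -> connected N -> N `<=` A `|` B ->
  N `&` A !=set0 -> N `&` B !=set0 ->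
  N `&` (A `&` B) !=set0.
Proof.
move=> clA clB cN NAB [a [Na Aa]] [b [Nb Bb]]; apply: contrapT => h.
have NAB0 y : N y -> A y -> B y -> False.
  by move=> Ny Ay By; apply: h; exists y.
have NA : N `&` A = N.
  apply: cN; first by exists a.
    exists (~` B); first exact: closed_openC.
    apply/seteqP; split => y [Ny]; first by split => // /NAB0; exact.
    by move=> nBy; split => //; case: (NAB _ Ny).
  by exists A.
have : (N `&` A) b by rewrite NA.
by move=> [_ Ab]; exact: NAB0 Bb.
Qed.

Section Ray.
Context {R : realType} {S : metricType R} (Y J Q : set S) (f : S -> R)
  (g : R -> S).
Context (YE : Y = J `|` Q) (JQ0 : J `&` Q = set0) (cptQ : compact Q)
  (cf : {within J, continuous f})
  (cg : {within (`]0, 1]%classic : set R), continuous g})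
  (fI : forall x, J x -> (`]0, 1]%classic : set R) (f x))
  (gJ : forall u, (`]0, 1]%classic : set R) u -> J (g u))
  (fK : forall x, J x -> g (f x) = x)
  (gK : forall u, (`]0, 1]%classic : set R) u -> f (g u) = u).

Let JnQ y : J y -> Q y -> False.
Proof. by move=> Jy Qy; have : (J `&` Q) y by []; rewrite JQ0. Qed.

Let JY : J `<=` Y. Proof. by rewrite YE => y; left. Qed.

Let QY : Q `<=` Y. Proof. by rewrite YE => y; right. Qed.

Let f_gt0 x : J x -> 0 < f x.
Proof. by move=> /fI; rewrite /= in_itv/= => /andP[]. Qed.

Let f_le1 x : J x -> f x <= 1.
Proof. by move=> /fI; rewrite /= in_itv/= => /andP[]. Qed.

Let arc u v : set S := g @` `[u, v].

Let sub_itv u v : 0 < u -> v <= 1 ->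
  (`[u, v]%classic : set R) `<=` (`]0, 1]%classic : set R).
Proof.
move=> u0 v1 w; rewrite /= !in_itv/= => /andP[uw wv].
by rewrite (lt_le_trans u0)// (le_trans wv).
Qed.

Let arcE u v : 0 < u -> v <= 1 -> arc u v = [set y | J y /\ u <= f y <= v].
Proof.
move=> u0 v1; apply/seteqP; split => y.
  move=> [w uvw <-]; have w01 := sub_itv u0 v1 uvw.
  by split; [exact: gJ|rewrite gK//; move: uvw; rewrite /= in_itv].
by move=> [Jy uyv]; exists (f y); [rewrite /= in_itv|exact: fK].
Qed.

Let compact_arc u v : 0 < u -> v <= 1 -> compact (arc u v).
Proof.
move=> u0 v1; apply: continuous_compact; last exact: segment_compact.
exact: continuous_subspaceW (sub_itv u0 v1) cg.
Qed.

Let connected_arc u v : 0 < u -> v <= 1 -> connected (arc u v).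
Proof.
move=> u0 v1; apply: connected_continuous_connected.
  exact: segment_connected.
exact: continuous_subspaceW (sub_itv u0 v1) cg.
Qed.

(** The point [g u] cuts [Y]: larger parameters are on one side, [Q] and the smaller parameters on
    the other. The closure of the first side stays in the compact arc from [u] to 1, and closedness
    of [Q] with continuity of [f] keeps the second side away from the first. *)
Lemma ray_cut P u : P `<=` Y -> connected P -> 0 < u <= 1 -> ~ P (g u) ->
  (forall y, P y -> J y /\ u < f y) \/ (forall y, P y -> J y -> f y < u).
Proof.
move=> PY cP /andP[u0 u1] nPu.
pose A := [set y | J y /\ u < f y].
pose B := Q `|` [set y | J y /\ f y < u].
have sepAB : separated A B.
  split; apply/seteqP; split => // y [].
    move=> clA; have : arc u 1 y.
      apply: (compact_metric_closed (compact_arc u0 (lexx 1))).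
      apply: closureS clA => z [Jz uz].
      by rewrite arcE//; split => //; rewrite (ltW uz) f_le1.
    rewrite arcE// => -[Jy /andP[uy _]] [Qy|[_]]; first exact: JnQ Qy.
    by rewrite ltNge uy.
  move=> [Jy uy] clB.
  have nQ : nbhs y (~` Q).
    apply: open_nbhs_nbhs; split; last exact: JnQ.
    by apply: closed_openC; exact: compact_metric_closed.
  have nJ : nbhs y [set z | J z -> u < f z].
    have /subspace_continuousP/(_ _ Jy) := cf.
    move=> /(_ [set w | u < w]) /=; apply.
    exact: lt_nbhsr.
  have [z [Bz [nQz]]] := clB _ (filterI nQ nJ).
  case: Bz => // -[Jz zu] /(_ Jz).
  by move=> /(lt_trans zu); rewrite ltxx.
case: (connected_subset sepAB _ cP).
- move=> y Py; have := PY _ Py; rewrite YE => -[Jy|]; last by right; left.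
  have [uy|yu|yu] := ltgtP u (f y); [by left|by right; right|].
  by exfalso; apply: nPu; rewrite yu fK.
- by left.
- by move=> PB; right => y /PB[Qy|[]//] /JnQ-/(_ Qy).
Qed.

(** A missed point [y] in between would cut [P] and leave [a] and [c] on different sides. *)
Lemma ray_between P a c : P `<=` Y -> connected P -> P a -> J a -> P c -> J c ->
  forall y, J y -> f a <= f y <= f c -> P y.
Proof.
move=> PY cP Pa Ja Pc Jc y Jy /andP[ay yc]; apply: contrapT => nPy.
have [||h|h] := @ray_cut P (f y) PY cP.
- by rewrite f_gt0// f_le1.
- by rewrite fK.
- by have [_] := h _ Pa; rewrite ltNge ay.
- by have := h _ Pc Jc; rewrite ltNge yc.
Qed.

(** By [ray_cut], [P] contains every point of [J] with parameter at most [f a]. These points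
    accumulate at all of [Q], since [J] is dense and the remaining arc is closed and misses [Q]. *)
Lemma ray_tail P a q : P `<=` Y -> connected P -> closed P ->
  Y `<=` closure J -> P a -> J a -> P q -> Q q -> Q `<=` P.
Proof.
move=> PY cP clP YJ Pa Ja Pq Qq.
have tailP y : J y -> f y <= f a -> P y.
  move=> Jy ya; apply: contrapT => nPy.
  have [||h|h] := @ray_cut P (f y) PY cP.
  - by rewrite f_gt0// f_le1.
  - by rewrite fK.
  - by have [/JnQ-/(_ Qq)] := h _ Pq.
  - by have := h _ Pa Ja; rewrite ltNge ya.
move=> y Qy; apply: clP => B By.
have nA : nbhs y (~` arc (f a) 1).
  apply: open_nbhs_nbhs; split.
    apply: closed_openC; apply: compact_metric_closed.
    by apply: compact_arc => //; exact: f_gt0.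
  by rewrite arcE ?f_gt0// => -[Jy _]; exact: JnQ Qy.
have [z [Jz [Bz nz]]] := YJ _ (QY Qy) _ (filterI By nA).
exists z; split => //; apply: tailP => //.
rewrite leNgt; apply/negP => az; apply: nz.
by rewrite arcE ?f_gt0//; split => //; rewrite (ltW az) f_le1.
Qed.

Lemma ray_window W a c : W `<=` Y -> connected W -> ~ W a -> J a -> ~ W c ->
  J c -> (exists b, [/\ W b, J b & f a <= f b <= f c]) ->
  forall y, W y -> J y /\ f a <= f y <= f c.
Proof.
move=> WY cW nWa Ja nWc Jc [b [Wb Jb /andP[ab bc]]].
have [||ha|ha] := @ray_cut W (f a) WY cW.
- by rewrite f_gt0// f_le1.
- by rewrite fK.
- have [||hc|hc] := @ray_cut W (f c) WY cW.
  + by rewrite f_gt0// f_le1.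
  + by rewrite fK.
  + by have [_] := hc _ Wb; rewrite ltNge bc.
  + move=> y Wy; have [Jy ay] := ha _ Wy.
    by split => //; rewrite !ltW//; exact: hc.
- by have := ha _ Wb Jb; rewrite ltNge ab.
Qed.

(** [N] touches the spheres of radius [r] about [p] and [q] without entering the open balls. The
    inequalities are not strict so that they survive Hausdorff limits. *)
Definition crossing (P N : set S) (p q : S) (r : R) :=
  [/\ subcontinuum P N, forall y, N y -> r <= mdist y p /\ r <= mdist y q,
    exists2 y, N y & mdist y p <= r & exists2 y, N y & mdist y q <= r].

(** From [a] towards [c], let [a'] be the last point within [r] of [p] and [c'] the first point
    after it within [r] of [q]; [N] is the arc between them. A connected [W] around [N] missing [a]
    and [c] is trapped between these two by [ray_window], hence in [P] by [ray_between]. *)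
Lemma ray_crossing P a c p q r : P `<=` Y -> connected P ->
  P a -> J a -> P c -> J c -> mdist a p <= r -> mdist c q <= r ->
  (forall x, mdist x p <= r -> mdist x q <= r -> False) ->
  exists N, crossing P N p q r /\
    forall W, connected W -> N `<=` W -> W `<=` Y -> ~ W a -> ~ W c -> W `<=` P.
Proof.
move=> PY cP.
(* The situation is symmetric under exchanging [a] with [c] and [p] with [q]; equal parameters would
   put one point in both balls. *)
wlog ac : a c p q / f a < f c.
  move=> wlg Pa Ja Pc Jc ap cq pq; have [ac|ca|ac] := ltgtP (f a) (f c).
  - exact: wlg ap cq pq.
  - have [|N [[sN Nr Np Nq] NW]] := wlg _ _ _ _ ca Pc Jc Pa Ja cq ap.
      by move=> x xq xp; exact: pq xq.
    exists N; split; first by split => // y /Nr[].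
    by move=> W cW NsW WY Wa Wc; exact: NW.
  - exfalso; apply: (pq c) => //.
    by rewrite -(fK Jc) -ac fK.
move=> Pa Ja Pc Jc ap cq pq.
have fa0 := f_gt0 Ja; have fc1 := f_le1 Jc.
have cfarc (A : set S) u v : 0 < u -> v <= 1 ->
    {within arc u v `&` A, continuous f}.
  move=> u0 v1; apply: continuous_subspaceW cf => y [].
  by rewrite arcE// => -[].
have [|||a' a'E a'max] := @compact_EVT_max _ _ f
    (arc (f a) (f c) `&` [set y | mdist y p <= r]).
- by exists a; split => //; rewrite arcE//; split => //; rewrite lexx ltW.
- by apply: compact_closedI; [exact: compact_arc|exact: closed_mdist_le].
- exact: cfarc.
move: a'E; rewrite inE arcE// => -[[Ja' /andP[aa' a'c]] a'p].
have fa'0 := f_gt0 Ja'.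
have [|||c' c'E c'min] := @compact_EVT_min _ _ f
    (arc (f a') (f c) `&` [set y | mdist y q <= r]).
- by exists c; split => //; rewrite arcE//; split => //; rewrite lexx a'c.
- by apply: compact_closedI; [exact: compact_arc|exact: closed_mdist_le].
- exact: cfarc.
move: c'E; rewrite inE arcE// => -[[Jc' /andP[a'c' c'c]] c'q].
have fc'1 := f_le1 Jc'.
pose N := arc (f a') (f c').
have NE : N = [set y | J y /\ f a' <= f y <= f c'] by exact: arcE.
have cN : connected N by exact: connected_arc.
have cptN : compact N by exact: compact_arc.
have Na' : N a' by rewrite NE; split => //; rewrite lexx.
have Nc' : N c' by rewrite NE; split => //; rewrite lexx andbT.
(* By the extremal choice of [a'], it is the only point of [N] in the closed ball about [p];
   likewise for [c'] and [q] below. *)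
have Np y : N y -> mdist y p <= r -> y = a'.
  rewrite NE => -[Jy /andP[a'y yc']] yp.
  rewrite -(fK Jy) -(fK Ja'); congr g; apply/eqP; rewrite eq_le a'y andbT.
  apply: a'max; rewrite inE arcE//; split => //; split => //.
  by rewrite (le_trans aa')// (le_trans yc').
have Nq y : N y -> mdist y q <= r -> y = c'.
  rewrite NE => -[Jy /andP[a'y yc']] yq.
  rewrite -(fK Jy) -(fK Jc'); congr g; apply/eqP; rewrite eq_le yc' /=.
  apply: c'min; rewrite inE arcE//; split => //; split => //.
  by rewrite a'y (le_trans yc').
(* If both alternatives failed, [z] would be an isolated point of the connected
   set [N]. *)
have far z z' o : N z -> N z' -> z <> z' -> r <= mdist z o \/
    exists y, [/\ N y, y <> z & mdist y o <= r].
  move=> Nz Nz' zz'; have [|zo] := leP r (mdist z o); first by left.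
  right; apply: contrapT => /forallNP h.
  have NB : N `&` [set y | mdist y o < r] = N.
    apply: cN.
    - by exists z.
    - by exists [set y | mdist y o < r] => //; exact: open_mdist_lt.
    - exists [set y | mdist y o <= r]; first exact: closed_mdist_le.
      apply/seteqP; split => y [Ny yo]; split => //=; first exact: ltW.
      have [->//|/eqP yz] := eqVneq y z.
      by exfalso; apply: (h y); split.
  have : (N `&` [set y | mdist y o < r]) z' by rewrite NB.
  move=> [_ /ltW z'o]; apply: (h z'); split => //.
  exact/nesym.
have a'c'D : a' <> c' by move=> e; apply: (pq a') => //; rewrite e.
have a'far : r <= mdist a' p.
  by have [//|[y [Ny ya' /(Np _ Ny)]]] := far a' c' p Na' Nc' a'c'D.
have c'far : r <= mdist c' q.
  have [//|[y [Ny yc' /(Nq _ Ny)//]]] := far c' a' q Nc' Na' (nesym a'c'D).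
exists N; split.
  split.
  - split => //; first by exists a'.
    move=> y; rewrite NE => -[Jy /andP[a'y yc']].
    apply: (ray_between PY cP Pa Ja Pc Jc Jy).
    by rewrite (le_trans aa')// (le_trans yc').
  - move=> y Ny; split.
      by have [yp|/ltW//] := leP (mdist y p) r; rewrite (Np _ Ny yp).
    by have [yq|/ltW//] := leP (mdist y q) r; rewrite (Nq _ Ny yq).
  - by exists a'.
  - by exists c'.
move=> W cW NW WY nWa nWc y Wy.
have [|Jy] := ray_window WY cW nWa Ja nWc Jc _ Wy.
  exists a'; split => //; first exact: NW.
  by rewrite aa' a'c.
exact: (ray_between PY cP Pa Ja Pc Jc Jy).
Qed.

(** * Maximal limit continua in a compactified ray *)

Context (cptY : compact Y) (YJ : Y `<=` closure J).

(** Singletons of points of [J] converging to [x] are extended to a maximal limit continuum; the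
    approximants meet [J] because they contain these points. *)
Lemma maximal_limit_through_point F x : subcontinuum Y F -> F x ->
  exists (L : set S) (L_ : nat -> set S),
  [/\ maximal_limit_continuum Y F L, L x,
    forall k, subcontinuum Y (L_ k) /\ J `&` L_ k !=set0 & hausdorff_near L_ L].
Proof.
move=> YF Fx; have [_ FY _ _] := YF.
have /choice[x_ x_P] : forall n, exists y, J y /\ mdist y x < eps n.
  move=> n; have /closureP/(_ _ (eps_gt0 R n))[y Jy yx] := YJ (FY _ Fx).
  by exists y.
have [||L [L_ [s [LF YL ks xL hL]]]] :=
    @maximal_limit_continuum_exists _ _ Y F (fun n => [set x_ n]) cptY YF.
- move=> n; split; [by exists (x_ n)| | exact: compact_set1|exact: connected1].
  by move=> _ ->; apply: JY; have [] := x_P n.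
- move=> e e0; apply: filterS (eps_near e0) => n ne _ ->.
  exists x => //; rewrite metric_sym (lt_trans _ ne)//.
  by have [] := x_P n.
exists L, L_; split => //.
- have [[_ _ cL _] _] := LF.
  apply: (hausdorff_near_closed (compact_metric_closed cL) hL) => e e0.
  have [n _ ne] := eps_near e0; exists n => // k nk; exists (x_ (s k)).
    exact: xL.
  apply: lt_trans (x_P (s k)).2 _; apply: ne.
  exact: leq_trans (ks k).
- move=> k; split => //; exists (x_ (s k)); split; last exact: xL.
  by have [] := x_P (s k).
Qed.

Context (skY : forall K, subcontinuum Y K -> forall L M,
  maximal_limit_continuum Y K L -> maximal_limit_continuum Y K M ->
  L `<=` M \/ M `<=` L).

(* The maximal limit continua of [F] through [p] and through [q] are nested, so
   the larger one contains both. *)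
Lemma maximal_limit_through_two_points F p q : subcontinuum Y F -> F p -> F q ->
  exists (L : set S) (L_ : nat -> set S), [/\ subcontinuum F L, L p, L q,
    forall k, subcontinuum Y (L_ k) /\ J `&` L_ k !=set0 & hausdorff_near L_ L].
Proof.
move=> YF Fp Fq.
have [L [L_ [LF Lp YL hL]]] := maximal_limit_through_point YF Fp.
have [M [M_ [MF Mq YM hM]]] := maximal_limit_through_point YF Fq.
have [LM|ML] := skY YF LF MF.
- by exists M, M_; split => //; [exact: MF.1|exact: LM].
- by exists L, L_; split => //; [exact: LF.1|exact: ML].
Qed.

(** [N] is a limit of arcs cut by [ray_crossing] from approximants of a continuum [L] in [F] through
    [p] and [q]. The point [z] outside [F] forces these approximants into [J]. Continua that extend
    the cut arcs and converge into [K] eventually miss the ends near [p] and [q], so they stay in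
    the uncut approximants and their limit stays in [L]. *)
Lemma limit_crossing F p q z r : subcontinuum Q F -> F p -> F q ->
  Q z -> ~ F z -> 0 < r ->
  (forall x, mdist x p <= r -> mdist x q <= r -> False) ->
  exists N, crossing F N p q r /\
    forall K, subcontinuum Y K -> N `<=` K -> ~ K p -> ~ K q ->
      exists M, [/\ maximal_limit_continuum Y K M, N `<=` M & M `<=` F].
Proof.
move=> [F0 FQ cF conF] Fp Fq Qz nFz r0 pq.
have YF : subcontinuum Y F by split => // y /FQ/QY.
have [L [L_ [[_ LF cptL conL] Lp Lq YL hL]]] :=
  maximal_limit_through_two_points YF Fp Fq.
have clL := compact_metric_closed cptL.
(* An [L_ k] meeting both [J] and [Q] contains [Q], hence [z]. *)
have L_J : \forall k \near \oo, L_ k `<=` J.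
  have [d d0 dL] := @mem_closed_far _ _ L z clL (fun Lz => nFz (LF _ Lz)).
  apply: filterS (hL _ d0) => k [Lk _].
  have [[_ LY cL conLk] [a [Ja La]]] := YL k.
  move=> y Ly; have := LY _ Ly; rewrite YE => -[//|Qy].
  have QL : Q `<=` L_ k.
    have clLk := compact_metric_closed cL.
    exact: (ray_tail LY conLk clLk YJ La Ja Ly Qy).
  by case: (dL z); [rewrite mdistxx|exact/Lk/QL].
(* The bound [r] is what [ray_crossing] asks of the ends of the arc, and [eps m] makes these ends
   converge to [p] and [q]. *)
have /choice[k_ k_P] : forall m, exists k, [/\ L_ k `<=` J,
    L_ k `<=` thickening L (eps m), thickening (L_ k) (Num.min r (eps m)) p &
    thickening (L_ k) (Num.min r (eps m)) q].
  move=> m; have m0 : 0 < Num.min r (eps m) by rewrite lt_min r0 eps_gt0.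
  have [k [[kJ [kL _]] [_ kpq]]] :=
    eventually_and_ex (filterI L_J (hL _ (eps_gt0 R m))) (hL _ m0).
  by exists k; split => //; exact: kpq.
pose P m := L_ (k_ m).
have PY m : P m `<=` Y by have [[]] := YL (k_ m).
have Pc m : connected (P m) by have [[]] := YL (k_ m).
have /choice[a aP] : forall m, exists a,
    P m a /\ mdist a p < Num.min r (eps m).
  by move=> m; have [_ _ [a Pa ap] _] := k_P m; exists a.
have /choice[c cP] : forall m, exists c,
    P m c /\ mdist c q < Num.min r (eps m).
  by move=> m; have [_ _ _ [c Pc' cq]] := k_P m; exists c.
have near_le m (x : R) : x < Num.min r (eps m) -> x <= r /\ x < eps m.
  by rewrite lt_min => /andP[/ltW].
have /choice[N_ N_P] : forall m, exists N, crossing (P m) N p q r /\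
    forall W, connected W -> N `<=` W -> W `<=` Y -> ~ W (a m) -> ~ W (c m) ->
      W `<=` P m.
  move=> m; have [PJ _ _ _] := k_P m.
  have [[Pa /near_le[ap _]] [Pc' /near_le[cq _]]] := (aP m, cP m).
  exact: (ray_crossing (PY m) (Pc m) Pa (PJ _ Pa)
    Pc' (PJ _ Pc') ap cq pq).
have YN m : subcontinuum Y (N_ m).
  have [[[N0 NP cptN cN] _ _ _] _] := N_P m.
  by split => // y /NP/PY.
have [N [s [[N0 NY cptN conN] ks hN]]] := subcontinuum_compactness cptY YN.
(* An arbitrary reindexing [t], because this is used along [s] for [N] and along [s \o t] for
   [M]. *)
have PL (t : nat -> nat) (e : R) : (forall k, (k <= t k)%N) -> 0 < e ->
    \forall k \near \oo, P (t k) `<=` thickening L e.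
  move=> kt /eps_near[n _ ne]; exists n => // k nk.
  have [_ PmL _ _] := k_P (t k); apply: subset_trans PmL _.
  by apply: thickeningS => //; apply: ltW; apply: ne; exact: leq_trans (kt k).
have NL : N `<=` L.
  apply: (hausdorff_near_subset clL hN) => e e0.
  apply: filterS (PL s _ ks e0) => k; apply: subset_trans.
  by have [[[_ ? _ _] _ _ _] _] := N_P (s k).
(* If the compact [N] missed the closed ball, so would some thickening of [N], which contains sets
   [N_ m] that meet the ball. *)
have reach o : (forall m, exists2 y, N_ m y & mdist y o <= r) ->
    exists2 y, N y & mdist y o <= r.
  move=> No; apply: contrapT => /forall2NP h.
  have [||e e0 eN] := @compact_sub_thickening _ _ N
      (~` [set y | mdist y o <= r]) cptN.
  - by apply: closed_openC; exact: closed_mdist_le.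
  - by move=> y Ny; case: (h y).
  have [k [kN _]] := filter_ex (hN _ e0).
  by have [y Ny yo] := No (s k); exact: (eN y (kN _ Ny)).
exists N; split.
  split.
  - by split => // y /NL/LF.
  - have clN o : (forall m y, N_ m y -> r <= mdist y o) ->
        forall y, N y -> r <= mdist y o.
      move=> No; apply: (hausdorff_near_subset (closed_mdist_ge (r := r)) hN).
      move=> e e0; apply: filterE => k y Ny; exists y; last by rewrite mdistxx.
      exact: No Ny.
    by move=> y Ny; split; apply: clN Ny => m z' Nz';
      have [[_ /(_ _ Nz')[]]] := N_P m.
  - by apply: reach => m; have [[]] := N_P m.
  - by apply: reach => m; have [[]] := N_P m.
move=> K YK NK nKp nKq.
have [||M [M_ [t [MK YM kt NM hM]]]] :=
    @maximal_limit_continuum_exists _ _ Y K (N_ \o s) cptY YK.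
- by move=> n; exact: YN.
- move=> e e0; apply: filterS (hN _ e0) => n [Nn _].
  by apply: subset_trans Nn _; exact: thickeningS.
have [[_ sMK cptM _] _] := MK.
have clM := compact_metric_closed cptM.
exists M; split => //.
  apply: (hausdorff_near_sub clM (hausdorff_near_subseq kt hN) hM).
  exact: filterE.
(* The point [o] is outside [K], hence at positive distance from [M]; the points [b m] tend to [o]
   while the sets [M_ k] tend to [M]. *)
have avoid o (b : nat -> S) : ~ K o -> (forall m, mdist (b m) o < eps m) ->
    \forall k \near \oo, ~ M_ k (b (s (t k))).
  move=> nKo bo.
  have [d d0 dM] := @mem_closed_far _ _ M o clM (fun h => nKo (sMK _ h)).
  have [n _ nd] := eps_near d0.
  apply: filterS2 (hM _ d0) (nbhs_infty_ge n) => k [Mk _] nk /Mk.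
  apply: dM; apply: lt_trans (bo _) _; apply: nd => /=.
  by rewrite (leq_trans nk)// (leq_trans (kt k)).
apply: subset_trans LF; apply: (hausdorff_near_subset clL hM) => e e0.
have h1 : \forall k \near \oo, ~ M_ k (a (s (t k))).
  by apply: (avoid p) => // m; have [_ /near_le[]] := aP m.
have h2 : \forall k \near \oo, ~ M_ k (c (s (t k))).
  by apply: (avoid q) => // m; have [_ /near_le[]] := cP m.
have h3 : \forall k \near \oo, P (s (t k)) `<=` thickening L e.
  by apply: (PL (s \o t)) => // k; exact: leq_trans (ks _).
apply: filterS3 h1 h2 h3 => k Ma Mc; apply: subset_trans.
have [_ NW] := N_P (s (t k)); have [_ MY _ cM] := YM k.
by apply: NW => //; exact: NM.
Qed.

(** The radius [r] is so small that the closed ball about [p1] misses those about [p2] and [p3], and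
    that each ball misses the two other legs. A point of [N] near [p2] and a point of [N'] near [p3]
    then refute both inclusions between the maximal limit continua. *)
Lemma no_triod_legs (B B1 B2 B3 : set S) p1 p2 p3 :
  subcontinuum Q B -> subcontinuum Q B1 -> subcontinuum Q B2 ->
  subcontinuum Q B3 -> B1 `&` B2 = B -> B1 `&` B3 = B -> B2 `&` B3 = B ->
  (B1 `\` B) p1 -> (B2 `\` B) p2 -> (B3 `\` B) p3 -> False.
Proof.
move=> QB QB1 QB2 QB3 B12 B13 B23 [Bp1 nBp1] [Bp2 nBp2] [Bp3 nBp3].
have [[b Bb] sBQ cptB conB] := QB.
have [_ sQ1 cpt1 con1] := QB1; have [_ sQ2 cpt2 con2] := QB2.
have [_ sQ3 cpt3 con3] := QB3.
have cl1 := compact_metric_closed cpt1.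
have cl2 := compact_metric_closed cpt2.
have cl3 := compact_metric_closed cpt3.
have n12 : ~ B1 p2 by move=> h; apply: nBp2; rewrite -B12.
have n13 : ~ B1 p3 by move=> h; apply: nBp3; rewrite -B13.
have n21 : ~ B2 p1 by move=> h; apply: nBp1; rewrite -B12.
have n23 : ~ B2 p3 by move=> h; apply: nBp3; rewrite -B23.
have n31 : ~ B3 p1 by move=> h; apply: nBp1; rewrite -B13.
have n32 : ~ B3 p2 by move=> h; apply: nBp2; rewrite -B23.
have disj (p q : S) : p != q -> \forall r \near 0^'+, forall x : S,
    mdist x p <= r -> mdist x q <= r -> False.
  rewrite -mdist_gt0 => pq; near=> r => x xp xq.
  have : mdist p q <= r + r.
    by rewrite (le_trans (metric_triangle p x q))// lerD// metric_sym.
  apply/negP; rewrite -ltNge [ltRHS]splitr.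
  by rewrite ltrD//; near: r; apply: nbhs_right_lt; rewrite divr_gt0.
have p12 : p1 != p2 by apply/eqP => e; apply: n12; rewrite -e.
have p13 : p1 != p3 by apply/eqP => e; apply: n13; rewrite -e.
near (@GRing.zero R)^'+ => r.
have r0 : 0 < r by [].
have QU A C : subcontinuum Q A -> subcontinuum Q C -> A `&` C = B ->
    subcontinuum Q (A `|` C).
  move=> [A0 AQ cptA cA] [_ CQ cptC cC] AC; split.
  - by have [x Ax] := A0; exists x; left.
  - by move=> x [/AQ|/CQ].
  - exact: compactU.
  - by apply: connectedU => //; rewrite AC; exists b.
(* Here [p3] is the point of [Q] outside the union of the two legs; [p2] takes this part for
   [N']. *)
have [||||||N [[[_ NF cptN conN] Nr [y1 Ny1 y1p] [y2 Ny2 y2p]] NK]] :=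
    @limit_crossing (B1 `|` B2) p1 p2 p3 r (QU _ _ QB1 QB2 B12).
- by left.
- by right.
- exact: sQ3.
- by case.
- exact: r0.
- near: r; exact: disj.
have [||||||N' [[[_ NF' cptN' conN'] Nr' [z1 Nz1 z1p] [z3 Nz3 z3p]] NK']] :=
    @limit_crossing (B1 `|` B3) p1 p3 p2 r (QU _ _ QB1 QB3 B13).
- by left.
- by right.
- exact: sQ2.
- by case.
- exact: r0.
- near: r; exact: disj.
have a12 : forall x, mdist x p1 <= r -> ~ B2 x.
  by near: r; exact: closed_ball_avoid.
have a13 : forall x, mdist x p1 <= r -> ~ B3 x.
  by near: r; exact: closed_ball_avoid.
have a21 : forall x, mdist x p2 <= r -> ~ B1 x.
  by near: r; exact: closed_ball_avoid.
have a23 : forall x, mdist x p2 <= r -> ~ B3 x.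
  by near: r; exact: closed_ball_avoid.
have a31 : forall x, mdist x p3 <= r -> ~ B1 x.
  by near: r; exact: closed_ball_avoid.
have a32 : forall x, mdist x p3 <= r -> ~ B2 x.
  by near: r; exact: closed_ball_avoid.
(* [N] has a point near [p1], which must be in [B1], and one near [p2], which must be in [B2], so it
   passes through [B]. This is what makes [K] connected. *)
have NB : N `&` B !=set0.
  rewrite -B12; apply: connected_meets_setI => //.
  - by exists y1; split => //; have [|/(a12 _ y1p)] := NF _ Ny1.
  - by exists y2; split => //; have [/(a21 _ y2p)|] := NF _ Ny2.
have N'B : N' `&` B !=set0.
  rewrite -B13; apply: connected_meets_setI => //.
  - by exists z1; split => //; have [|/(a13 _ z1p)] := NF' _ Nz1.
  - by exists z3; split => //; have [/(a31 _ z3p)|] := NF' _ Nz3.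
have notin (A : set S) o : (forall y, A y -> r <= mdist y o) -> ~ A o.
  by move=> h /h; rewrite mdistxx leNgt r0.
pose K := (N `|` B) `|` N'.
have YK : subcontinuum Y K.
  split.
  - by exists b; left; right.
  - move=> x [[/NF|/sBQ/QY//]|/NF'] [].
    + by move=> /sQ1/QY.
    + by move=> /sQ2/QY.
    + by move=> /sQ1/QY.
    + by move=> /sQ3/QY.
  - by do 2![apply: compactU => //].
  - apply: connectedU => //; last by apply: connectedU.
    by have [x [Nx Bx]] := N'B; exists x; split => //; right.
have nK1 : ~ K p1.
  move=> [[|//]|]; apply: notin => y; first by move=> /Nr[].
  by move=> /Nr'[].
have nK2 : ~ K p2.
  move=> [[|//]|]; first by apply: notin => y /Nr[].
  by move=> /NF'[].
have nK3 : ~ K p3.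
  move=> [[|//]|]; first by move=> /NF[].
  by apply: notin => y /Nr'[].
have [|M [MK NM MF]] := NK K YK _ nK1 nK2; first by move=> x Nx; left; left.
have [|M' [MK' NM' MF']] := NK' K YK _ nK1 nK3; first by move=> x Nx; right.
(* If [M] is in [M'], the point [y2] near [p2] lies in [B1] or [B3]; in the other case [z3] near
   [p3] lies in [B1] or [B2]. *)
have [MM'|M'M] := skY YK MK MK'.
  by have [/(a21 _ y2p)|/(a23 _ y2p)] := MF' _ (MM' _ (NM _ Ny2)).
by have [/(a31 _ z3p)|/(a32 _ z3p)] := MF _ (M'M _ (NM' _ Nz3)).
Unshelve. all: by end_near. Qed.

End Ray.

(** * The legs of a 3-od *)

Section Separation.
Context {T : topologicalType}.
Implicit Types (A B C U V W Z : set T).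

Lemma separatedS A B C : C `<=` B -> separated A B -> separated A C.
Proof.
move=> CB [AB BA]; split; apply/seteqP; split => // x [].
  by move=> clAx /CB Bx; rewrite -AB.
by move=> Ax /(closureS CB) clBx; rewrite -BA.
Qed.

Lemma separatedU A B C :
  separated A B -> separated A C -> separated A (B `|` C).
Proof.
move=> [AB BA] [AC CA]; split.
  by rewrite setIUr AB AC setU0.
by rewrite closureU setIUr BA CA setU0.
Qed.

(** [A] splits into two separated pieces. Were both connected, two of the three points would share a
    piece and hence a component, so one piece splits again. *)
Lemma three_components_split A x1 x2 x3 : A x1 -> A x2 -> A x3 ->
  connected_component A x1 <> connected_component A x2 ->
  connected_component A x1 <> connected_component A x3 ->
  connected_component A x2 <> connected_component A x3 ->
  exists U V W, [/\ A = U `|` (V `|` W), [/\ U !=set0, V !=set0 & W !=set0],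
    separated U (V `|` W), separated V (U `|` W) & separated W (U `|` V)].
Proof.
move=> A1 A2 A3 d12 d13 d23.
have together C x y : C `<=` A -> connected C -> C x -> C y ->
    connected_component A x = connected_component A y.
  move=> CA cC Cx Cy; apply: same_connected_component.
  by exists C.
have split2 U V' : A = U `|` V' -> separated U V' -> U !=set0 ->
    ~ connected V' -> exists U V W, [/\ A = U `|` (V `|` W),
    [/\ U !=set0, V !=set0 & W !=set0], separated U (V `|` W),
    separated V (U `|` W) & separated W (U `|` V)].
  move=> AE sUV' U0 /connectedPn[E [E0 V'E sE]].
  exists U, (E false), (E true); rewrite -V'E; split => //.
  - apply: separatedU => //; rewrite separatedC; apply: separatedS sUV'.
    by rewrite V'E => x; left.
  - apply: separatedU; last by rewrite separatedC.
    rewrite separatedC; apply: separatedS sUV'.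
    by rewrite V'E => x; right.
have [E [E0 AE sE]] : exists E : bool -> set T, [/\ forall b, E b !=set0,
    A = E false `|` E true & separated (E false) (E true)].
  by apply/connectedPn => cA; apply: d12; exact: (together A).
have [c0|c0] := pselect (connected (E false)); last first.
  apply: (split2 (E true) (E false)) => //; first by rewrite setUC.
  by rewrite separatedC.
have [c1|c1] := pselect (connected (E true)); last first.
  exact: (split2 (E false) (E true)).
have subE b : E b `<=` A by rewrite AE; case: b => x; [right|left].
have {}together := together _ _ _ (subE _).
(* Pigeonhole: each of the eight distributions puts two of the points into one connected piece. *)
move: A1 A2 A3; rewrite {1 2 3}AE => -[] h1 [] h2 [] h3; exfalso.
- by apply: d12; exact: (together _ _ _ c0).
- by apply: d12; exact: (together _ _ _ c0).
- by apply: d13; exact: (together _ _ _ c0).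
- by apply: d23; exact: (together _ _ _ c1).
- by apply: d23; exact: (together _ _ _ c0).
- by apply: d13; exact: (together _ _ _ c1).
- by apply: d12; exact: (together _ _ _ c1).
- by apply: d12; exact: (together _ _ _ c1).
Qed.

(** In a separation of the union of [B] and [U], the connected [B] lies in one part [F], so the
    other part [G] lies in [U]. Then [G] is separated from [V] as well as from [F], and this
    disconnects [Z]. *)
Lemma connected_setU_separated Z B U V : connected Z -> connected B ->
  Z = B `|` (U `|` V) -> separated U V -> B `&` U = set0 -> connected (B `|` U).
Proof.
move=> cZ cB ZE sUV BU0; apply/connectedP => E [E0 BUE sE].
have BE : B `<=` E false `|` E true by rewrite -BUE => x; left.
have key F G : G !=set0 -> F !=set0 -> B `|` U = F `|` G -> separated F G ->
    B `<=` F -> False.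
  move=> [y Gy] [x Fx] BUE' sFG BF.
  have GU : G `<=` U.
    move=> w Gw; have : (B `|` U) w by rewrite BUE'; right.
    move=> [/BF Fw|//]; have : (F `&` G) w by [].
    by rewrite (separated_disjoint sFG).
  have sGFV : separated G (F `|` V).
    apply: separatedU; first by rewrite separatedC.
    by rewrite separatedC; apply: (separatedS GU); rewrite separatedC.
  have ZGFV : Z = G `|` (F `|` V) by rewrite ZE setUA BUE' (setUC F) setUA.
  have disj := separated_disjoint sGFV.
  have ZsGFV : Z `<=` G `|` (F `|` V) by rewrite {1}ZGFV.
  have [h|h] := connected_subset sGFV ZsGFV cZ.
    have : (G `&` (F `|` V)) x by split; [apply: h; rewrite ZGFV; right|]; left.
    by rewrite disj.
  have : (G `&` (F `|` V)) y by split => //; apply: h; rewrite ZGFV; left.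
  by rewrite disj.
have [BF|BG] := connected_subset sE BE cB.
  exact: (key (E false) (E true)).
apply: (key (E true) (E false)) => //; first by rewrite BUE setUC.
by rewrite separatedC.
Qed.

Lemma closed_setU_separated Z B U V : closed Z -> closed B ->
  Z = B `|` (U `|` V) -> separated U V -> closed (B `|` U).
Proof.
move=> clZ clB ZE [UV VU] x; rewrite closureU -(closure_id B).1// => -[|clU].
  by left.
have : Z x.
  by apply: clZ; apply: closureS clU; rewrite ZE => y; right; left.
rewrite ZE => -[|[|Vx]]; [by left|by right|].
have : (closure U `&` V) x by [].
by rewrite UV.
Qed.

End Separation.

(** The complement of the core [B] splits into three mutually separated sets; adding [B] to each of
    them gives the legs. *)
Lemma three_od_legs (R : realType) (T : metricType R) (Z : set T) :
  three_od Z ->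
  exists B B1 B2 B3, [/\ [/\ subcontinuum Z B, subcontinuum Z B1,
      subcontinuum Z B2 & subcontinuum Z B3],
    [/\ B1 `&` B2 = B, B1 `&` B3 = B & B2 `&` B3 = B] &
    [/\ B1 `\` B !=set0, B2 `\` B !=set0 & B3 `\` B !=set0]].
Proof.
move=> [[cptZ cZ _] [B [ZB [C1 [C2 [C3 [[]]]]]]]].
move=> [x1 A1 <-] [x2 A2 <-] [x3 A3 <-] [d12 d13 d23].
have [U1 [U2 [U3 [AE [U10 U20 U30] s1 s2 s3]]]] :=
  three_components_split A1 A2 A3 d12 d13 d23.
have [B0 sBZ cptB cB] := ZB.
have clZ := compact_metric_closed cptZ.
have clB := compact_metric_closed cptB.
have ZE : Z = B `|` (U1 `|` (U2 `|` U3)).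
  by rewrite -AE setUDr setDv setD0; apply/esym/setUidr.
have nB y : (Z `\` B) y -> ~ B y by case.
have leg U V : Z `\` B = U `|` V -> separated U V -> U !=set0 ->
    [/\ subcontinuum Z (B `|` U), (B `|` U) `\` B !=set0 & B `&` U = set0].
  move=> UV sUV [x Ux].
  have ZUV : Z = B `|` (U `|` V) by rewrite -UV -AE in ZE *.
  have BU0 : B `&` U = set0.
    apply/seteqP; split => // y [By Uy]; apply: (nB y) => //.
    by rewrite UV; left.
  have UZ : B `|` U `<=` Z by rewrite ZUV => y [|]; [left|right; left].
  split => //.
  - split => //.
    + by have [y By] := B0; exists y; left.
    + apply: (subclosed_compact _ cptZ) => //.
      exact: (closed_setU_separated clZ clB ZUV).
    + exact: (connected_setU_separated cZ cB ZUV).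
  - exists x; split; first by right.
    by apply: nB; rewrite UV; left.
have [Z1 L1 BU1] := leg _ _ AE s1 U10.
have [|Z2 L2 BU2] := leg U2 (U1 `|` U3) _ s2 U20; first by rewrite AE setUCA.
have [|Z3 L3 BU3] := leg U3 (U1 `|` U2) _ s3 U30.
  by rewrite AE [RHS]setUC setUA.
exists B, (B `|` U1), (B `|` U2), (B `|` U3).
have d (U V W : set T) :
    separated U (V `|` W) -> U `&` V = set0 /\ U `&` W = set0.
  move=> /separated_disjoint; rewrite setIUr => h.
  by split; apply/seteqP; split => // y Uy; rewrite -h; [left|right].
have [U12 U13] := d _ _ _ s1; have [_ U23] := d _ _ _ s2.
by split=> //; split; rewrite -setUIr ?U12 ?U13 ?U23 setU0.
Qed.

(** * Transfer of the legs to the remainder *)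

Theorem theorem4p2 (R : realType) (T : metricType R) (X : set T) :
  continuum X -> semi_Kelley_remainder X -> atriodic X.
Proof.
move=> contX [S [Y [J [Q [[contY YE JQ0 homJ YJ] [_ skY] homX]]]]].
split => // Z [_ ZX _ _] /three_od_legs.
move=> [B [B1 [B2 [B3 [[ZB ZB1 ZB2 ZB3] [B12 B13 B23]]]]]].
move=> [[q1 Bq1] [q2 Bq2] [q3 Bq3]].
have [f [g [[cf cg] fJ gJ fK gK]]] := homJ.
have [h [h' [[ch _] hXQ hQX hK h'K]]] := homX.
have [cptX _ _] := contX; have [cptY _ _] := contY.
have XZ A : subcontinuum Z A -> A `<=` X by move=> [_ /subset_trans/(_ ZX)].
(* The legs are moved into [Q] by [h]: continuity preserves subcontinua, and injectivity on [X]
   preserves intersections and differences. *)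
have QE : Q = h @` X.
  apply/seteqP; split => y; last by move=> [x Xx <-]; exact: hXQ.
  by move=> Qy; exists (h' y); [exact: hQX|exact: h'K].
have cptQ : compact Q by rewrite QE; exact: continuous_compact.
have chA A : subcontinuum Z A -> {within A, continuous h}.
  by move=> /XZ AX; exact: continuous_subspaceW ch.
have hsub A : subcontinuum Z A -> subcontinuum Q (h @` A).
  move=> ZA; have := ZA; move=> [[x Ax] _ cptA cA]; split.
  - by exists (h x), x.
  - by move=> _ [y Ay <-]; apply: hXQ; exact: XZ ZA _ Ay.
  - by apply: continuous_compact => //; exact: chA.
  - by apply: connected_continuous_connected => //; exact: chA.
have hinj x y : X x -> X y -> h x = h y -> x = y.
  by move=> Xx Xy hxy; rewrite -(hK _ Xx) hxy hK.
have hI A C : subcontinuum Z A -> subcontinuum Z C ->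
    (h @` A) `&` (h @` C) = h @` (A `&` C).
  move=> /XZ AX /XZ CX; apply/seteqP; split => y.
    move=> [[a Aa <-] [c Cc]] hca; exists a => //; split => //.
    by rewrite -(hinj _ _ (CX _ Cc) (AX _ Aa) hca).
  by move=> [x [Ax Cx] <-]; split; exists x.
have hD A q : subcontinuum Z A -> (A `\` B) q -> (h @` A `\` h @` B) (h q).
  move=> /XZ AX [Aq nBq]; split; first by exists q.
  move=> [b Bb hbq]; apply: nBq.
  by rewrite -(hinj _ _ (XZ _ ZB _ Bb) (AX _ Aq) hbq).
apply: (no_triod_legs YE JQ0 cptQ cf cg fJ gJ fK gK cptY YJ skY
  (hsub _ ZB) (hsub _ ZB1) (hsub _ ZB2) (hsub _ ZB3) _ _ _
  (hD _ _ ZB1 Bq1) (hD _ _ ZB2 Bq2) (hD _ _ ZB3 Bq3)).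
- by rewrite hI// B12.
- by rewrite hI// B13.
- by rewrite hI// B23.
Qed.
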